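(* Let $R$ be an integral domain with quotient field $K$. Let $Z$ be the prime subring of $R$, and let $Q$ be the quotient field of $Z$. If $R$ satisfies any one of the following conditions (1)–(7), then $R$ is hereditarily atomic if and only if $R$ is hereditarily ACCP. (1) There exists $u\in R^\times$ such that $u$ is not integral over $Z$, and there exists $x\in R$ such that $x$ is transcendental over $Q(u)$. (2) The field $K$ has positive characteristic, and it is algebraic over $Q$. (3) One of the following conditions holds: - $K$ has positive characteristic, $R$ satisfies ACCP, and the transcendence degree of $K$ over $Q$ is not $1$; - $K$ has characteristic zero, $R$ satisfies ACCP, and the transcendence degree of $K$ over $Q$ is at least $2$. (4) There exists a sequence $(y_n)_{n\in\mathbb{N}}$ whose terms are nonunits in $R$, together with an element $x\in\bigcap_{n\in\mathbb{N}}(y_1\cdots y_n)$ that is transcendental over the field $Q(y_n\mid n\in\mathbb{N})$. (5) There exists a strictly ascending chain $\big((x_n)\big)_{n\in\mathbb{N}_0}$ of principal ideals of $R$ such that $x_0$ is transcendental over the field $Q\big(\tfrac{x_n}{x_{n+1}}\mid n\in\mathbb{N}_0\big)$. (6) There exist a nonzero nonunit $x\in R$ and a sequence $(y_n)_{n\in\mathbb{N}}$ whose terms are nonzero nonunits in $R$, with $x\in\bigcap_{n\in\mathbb{N}}(y_1\cdots y_n)$, giving a strictly ascending chain of principal ideals of $R$ $$(x)\subsetneq\Big(\frac{x}{y_1}\Big)\subsetneq\cdots\subsetneq\Big(\frac{x}{y_1y_2\cdots y_n}\Big)\subsetneq\cdots$$ such that $Z[y_n\mid n\in\mathbb{N}]\cap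 P=(0)$, where $P\subset R$ is the ideal $\Big(x,\frac{x}{y_1},\dots,\frac{x}{y_1y_2\cdots y_n},\dots\Big)$ of $R$. (7) The multiplicative subset of $R$ defined by $$\{z\in R^*\mid (z)=R \text{ or there is an infinite chain of distinct principal ideals ascending from } (z)\}$$ is a saturated set that is not contained in $R^\times$.
   Context: $\mathbb{N}$ denotes the positive integers and $\mathbb{N}_0$ the nonnegative integers. $R^*$ is the multiplicative monoid of nonzero elements of $R$, and $R^\times$ is the group of units of $R$. For $a\in R$, $(a)=Ra$ is the principal ideal of $R$ generated by $a$. An integral domain is atomic if every nonzero nonunit element factors into (finitely many) irreducible elements; it satisfies ACCP (the ascending chain condition on principal ideals) if every increasing sequence of principal ideals eventually stabilizes. An integral domain is hereditarily atomic if every one of its subrings (with the same identity) is atomic, and hereditarily ACCP if every one of its subrings satisfies ACCP. An ascending chain of ideals $(I_n)_{n\in\mathbb{N}}$ of $R$ is said to ascend from $I_1$. A multiplicative subset $S$ of $R$ is saturated if it is a divisor-closed submonoid of $R^*$ (i.e., every divisor in $R$ of an element of $S$ belongs to $S$). *)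

(* Defs.v *)
From HB Require Import structures.
From mathcomp Require Import all_boot all_order all_algebra.
From mathcomp Require Import boolp classical_sets functions cardinality.
From mathcomp Require Import mpoly.

Set Implicit Arguments.
Unset Strict Implicit.
Unset Printing Implicit Defensive.

Import GRing.Theory.
Local Open Scope classical_set_scope.
Local Open Scope ring_scope.

(* A subring of R is a subset S : set R; arithmetic relative to S (units,
   irreducibles, principal ideals) is expressed inside R, and R itself is the
   subring [set: R]. *)

Definition is_subring (R : nzRingType) (S : set R) : Prop :=
  GRing.subring_closed (mem S).

Definition is_subfield (K : fieldType) (F : set K) : Prop :=
  GRing.divring_closed (mem F).

Definition is_ideal (R : comNzRingType) (I : set R) : Prop :=
  [/\ I 0, (forall x y, I x -> I y -> I (x + y))
         & (forall a x, I x -> I (a * x))].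

Definition unit_in (R : idomainType) (S : set R) (a : R) : Prop :=
  S a /\ exists2 b, S b & a * b = 1.

Definition irreducible_in (R : idomainType) (S : set R) (a : R) : Prop :=
  [/\ S a, a != 0, ~ unit_in S a &
      forall b c, S b -> S c -> a = b * c -> unit_in S b \/ unit_in S c].

Definition principal_in (R : idomainType) (S : set R) (a : R) : set R :=
  [set s * a | s in S].

Definition atomic (R : idomainType) (S : set R) : Prop :=
  forall a, S a -> a != 0 -> ~ unit_in S a ->
  exists2 s : seq R, (forall x, x \in s -> irreducible_in S x)
                   & a = \prod_(x <- s) x.

Definition ACCP (R : idomainType) (S : set R) : Prop :=
  forall a : nat -> R, (forall n, S (a n)) ->
  (forall n, principal_in S (a n) `<=` principal_in S (a n.+1)) ->
  exists N, forall n, (N <= n)%N -> principal_in S (a n) = principal_in S (a N).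

Definition hereditarily_atomic (R : idomainType) : Prop :=
  forall S : set R, is_subring S -> atomic S.

Definition hereditarily_ACCP (R : idomainType) : Prop :=
  forall S : set R, is_subring S -> ACCP S.

Definition principal (R : idomainType) (a : R) : set R :=
  principal_in [set: R] a.

Definition prime_subring (R : nzRingType) : set R :=
  range (fun n : int => n%:~R : R).
Arguments prime_subring : clear implicits.

Definition ring_adjoin (R : nzRingType) (S A : set R) : set R :=
  smallest (@is_subring R) (S `|` A).

Definition field_adjoin (K : fieldType) (F A : set K) : set K :=
  smallest (@is_subfield K) (F `|` A).

Definition ideal_gen (R : comNzRingType) (A : set R) : set R :=
  smallest (@is_ideal R) A.

Definition prime_quotient_field (R : idomainType) : set {fraction R} :=
  [set tofrac a / tofrac b | a in prime_subring R & b in prime_subring R `\ 0].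
Arguments prime_quotient_field : clear implicits.

Definition integral_over (R : nzRingType) (S : set R) (u : R) : Prop :=
  exists p : {poly R}, [/\ p \is monic, p \is a polyOver (mem S) & root p u].

Definition algebraic_over (K : fieldType) (F : set K) (x : K) : Prop :=
  exists p : {poly K}, [/\ p != 0, p \is a polyOver (mem F) & root p x].

Definition transcendental_over (K : fieldType) (F : set K) (x : K) : Prop :=
  ~ algebraic_over F x.

Definition algebraically_independent (K : fieldType) (F B : set K) : Prop :=
  forall (n : nat) (b : 'I_n -> K), injective b -> (forall i, B (b i)) ->
  forall p : {mpoly K[n]}, p \is a mpolyOver n (mem F) -> p.@[b] = 0 -> p = 0.

Definition transcendence_basis (K : fieldType) (F B : set K) : Prop :=
  algebraically_independent F B /\
  forall x, algebraic_over (field_adjoin F B) x.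

(* The transcendence degree of K over F is a cardinal, the common cardinality
   of all transcendence bases; it is compared with a natural number by
   comparing a transcendence basis with `I_n. *)
Definition trdeg_eq (K : fieldType) (F : set K) (n : nat) : Prop :=
  exists2 B, transcendence_basis F B & (B #= `I_n)%card.

Definition trdeg_ge (K : fieldType) (F : set K) (n : nat) : Prop :=
  exists2 B, transcendence_basis F B & (`I_n #<= B)%card.

Definition positive_char (K : fieldType) : Prop := exists p, p \in [pchar K].

Definition zero_char (K : fieldType) : Prop := [pchar K] =i pred0.

Definition saturated (R : idomainType) (S : set R) : Prop :=
  [/\ S `<=` [set x | x != 0], S 1,
      (forall x y, S x -> S y -> S (x * y))
    & (forall x d c, S x -> x = d * c -> S d)].

Definition infinite_chain_from (R : idomainType) (z : R) : Prop :=
  exists a : nat -> R,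
    [/\ principal (a 0%N) = principal z,
        (forall n, principal (a n) `<=` principal (a n.+1))
      & injective (fun n => principal (a n))].

(* Main.v *)
Require Import Defs.
From HB Require Import structures.
From mathcomp Require Import all_boot all_order all_algebra.
From mathcomp Require Import boolp classical_sets functions cardinality.
From mathcomp Require Import mpoly generic_quotient.

Set Implicit Arguments.
Unset Strict Implicit.
Unset Printing Implicit Defensive.

Import GRing.Theory.
Local Open Scope classical_set_scope.
Local Open Scope ring_scope.

(** Hereditary ACCP implies hereditary atomicity because ACCP implies atomicity
in each subring ([atomic_of_ACCP]).  For the converse, the seven conditions
fall into two groups.

Conditions (1), (4), (5), (6) and (7) are incompatible with hereditary
atomicity.  In (7), a nonunit of the saturated set would have an irreducible
divisor from which an infinite chain of principal ideals ascends; but the only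
principal ideals above [(d)] with [d] irreducible are [(d)] and the whole ring
([atomic_no_chain_divisor]).  In the other four, there are a subring [A] and
elements [z n = y n * z n.+1], the [y n] being nonunits of [A], such that the
multiples of the [z n] form an ideal [P] of a larger ring with [P] and [A]
meeting only in 0.  Then [A + P] is not atomic: [P] is a prime ideal of it, so a
factorization of [z 0] into irreducibles has a factor in [P], while every
element of [P] is some [y n] times an element of [P]
([chain_not_hereditarily_atomic]).  In (4) and (5) the trivial intersection
comes from transcendence ([transcendental_not_hereditarily_atomic]), and (1) is
the same construction with [y n = u^-1] and [z n = u ^ n * x]: as [u] is not
integral over [Z], its inverse is a nonunit of [Z[u^-1]].

Conditions (2) and (3) concern rings in which the ascending chain condition is
inherited.  In (2) every subring is a field, since the inverse of [s] is
integral over the field [Z], hence a polynomial in [s] ([integral_inv_mem]).  In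
(3), if all units of [R] are integral over [Z], then a stabilizing chain in [R]
already stabilizes in each subring [S]: the quotients of consecutive generators
are elements of [S] that are units of [R], and their inverses lie in [S] by
[integral_inv_mem] again.  If some unit [u] is not integral over [Z], the
condition on the transcendence degree gives an element transcendental over
[Q(u)], and (1) applies.  In characteristic zero this uses the exchange
property: two elements algebraic over [Q(u)] are algebraically dependent over
[Q] ([algebraic_adjoin1_dependent]).  In positive characteristic, [u] is
transcendental over [Q], and if no element were transcendental over [Q(u)] then
[u] alone would be a transcendence basis. *)

(** * Subrings as sets *)

(** Depending on the proof of closure, this predicate can carry the canonical
structures that the [rpred] lemmas look for. *)
Definition subring_pred (R : nzRingType) (S : set R) of is_subring S :
  {pred R} := mem S.

HB.instance Definition _ (R : nzRingType) (S : set R) (HS : is_subring S) :=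
  GRing.isSubringClosed.Build R (subring_pred HS) HS.

Lemma is_subringP (R : nzRingType) (S : set R) :
  is_subring S <->
  [/\ S 1, forall a b, S a -> S b -> S (a - b)
         & forall a b, S a -> S b -> S (a * b)].
Proof.
split=> -[S1 SB SM].
  split=> [|a b Sa Sb|a b Sa Sb]; first by rewrite -in_setE.
    by rewrite -in_setE; apply: SB; rewrite in_setE.
  by rewrite -in_setE; apply: SM; rewrite in_setE.
split=> [|a b|a b]; first by rewrite in_setE.
  by rewrite !in_setE; apply: SB.
by rewrite !in_setE; apply: SM.
Qed.

Lemma in_subring_pred (R : nzRingType) (S : set R) (HS : is_subring S) a :
  (a \in subring_pred HS) = (a \in S).
Proof. by []. Qed.

Lemma subringT (R : nzRingType) : is_subring [set: R].
Proof. by apply/is_subringP. Qed.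

Lemma ring_adjoin_subring (R : nzRingType) (S A : set R) :
  is_subring (ring_adjoin S A).
Proof.
apply/is_subringP; split=> [|a b Sa Sb|a b Sa Sb] T [HT sT];
  have [T1 TB TM] := (is_subringP T).1 HT => //.
- by apply: TB; [apply: Sa|apply: Sb].
- by apply: TM; [apply: Sa|apply: Sb].
Qed.

Lemma prime_subring_subring (R : nzRingType) : is_subring (prime_subring R).
Proof.
apply/is_subringP; split=> [|_ _ [m _ <-] [n _ <-]|_ _ [m _ <-] [n _ <-]].
- by exists 1.
- by exists (m - n) => //; rewrite rmorphB.
- by exists (m * n) => //; rewrite rmorphM.
Qed.

Lemma prime_subring_sub (R : nzRingType) (S : set R) :
  is_subring S -> prime_subring R `<=` S.
Proof.
move=> HS _ [n _ <-]; rewrite -in_setE -(in_subring_pred HS).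
exact: rpred_int.
Qed.

Lemma image_subring (R S : nzRingType) (f : {rmorphism R -> S}) (A : set R) :
  is_subring A -> is_subring (f @` A).
Proof.
move=> /is_subringP[A1 AB AM].
apply/is_subringP; split=> [|_ _ [a Aa <-] [b Ab <-]|_ _ [a Aa <-] [b Ab <-]].
- by exists 1; rewrite ?rmorph1.
- by exists (a - b); rewrite ?rmorphB //; exact: AB.
- by exists (a * b); rewrite ?rmorphM //; exact: AM.
Qed.

Lemma subring0 (R : nzRingType) (S : set R) : is_subring S -> S 0.
Proof. by case/is_subringP=> S1 SB _; rewrite -(subrr 1); exact: SB. Qed.

Lemma polyOver_setP (R : nzRingType) (S : set R) (p : {poly R}) :
  S 0 -> p \is a polyOver (mem S) <-> forall i, S p`_i.
Proof.
move=> S0; split=> [/allP Sp i|Sp].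
  have [lt_ip|le_pi] := ltnP i (size p); last by rewrite nth_default.
  by have := Sp _ (mem_nth 0 lt_ip); rewrite /= in_setE.
apply/(all_nthP 0) => i _ /=; rewrite in_setE; exact: Sp.
Qed.

Definition eval_ring (R : comNzRingType) (A : set R) (x : R) : set R :=
  [set p.[x] | p in [set p : {poly R} | p \is a polyOver (mem A)]].

Lemma eval_ring_subring (R : comNzRingType) (A : set R) (x : R) :
  is_subring A -> is_subring (eval_ring A x).
Proof.
move=> HA; apply/is_subringP.
split=> [|_ _ [p Ap <-] [q Aq <-]|_ _ [p Ap <-] [q Aq <-]].
- exists 1; rewrite ?hornerE //.
  by change (1 \is a @polyOver R (subring_pred HA)); exact: rpred1.
- exists (p - q); rewrite ?hornerE //.
  by change (p - q \is a @polyOver R (subring_pred HA)); exact: rpredB.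
- exists (p * q); rewrite ?hornerE //.
  by change (p * q \is a @polyOver R (subring_pred HA)); exact: rpredM.
Qed.

Lemma eval_ring_sub (R : comNzRingType) (A : set R) (x : R) :
  is_subring A -> A `<=` eval_ring A x.
Proof.
move=> HA a Aa; exists a%:P; rewrite ?hornerE //.
by rewrite /= (polyOverC (subring_pred HA)) in_subring_pred in_setE.
Qed.

Lemma eval_ring_gen (R : comNzRingType) (A : set R) (x : R) :
  is_subring A -> eval_ring A x x.
Proof.
by move=> HA; exists 'X; rewrite ?hornerX //= (polyOverX (subring_pred HA)).
Qed.

Lemma eval_ring_min (R : comNzRingType) (A T : set R) (x : R) :
  is_subring T -> A `<=` T -> T x -> eval_ring A x `<=` T.
Proof.
move=> HT AT Tx _ [p Ap <-]; rewrite -in_setE -(in_subring_pred HT).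
apply: rpred_horner; last by rewrite in_subring_pred in_setE.
by apply: polyOverS Ap => a; rewrite !in_setE; exact: AT.
Qed.

(** * Atomicity and chains of principal ideals *)

Lemma principal_in_mono (R : idomainType) (S : set R) (a b s : R) :
  is_subring S -> S s -> a = s * b -> principal_in S a `<=` principal_in S b.
Proof.
move=> /is_subringP[_ _ SM] Ss -> _ [t St <-]; exists (t * s); first exact: SM.
by rewrite mulrA.
Qed.

Lemma principal_in_self (R : idomainType) (S : set R) (a : R) :
  is_subring S -> principal_in S a a.
Proof. by case/is_subringP=> S1 _ _; exists 1; rewrite ?mul1r. Qed.

Lemma principal_inP (R : idomainType) (S : set R) (a b : R) :
  is_subring S ->
  principal_in S a `<=` principal_in S b <-> exists2 s, S s & a = s * b.
Proof.
move=> HS; split=> [/(_ _ (principal_in_self a HS))[s Ss <-]|[s Ss eq_a]].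
  by exists s.
exact: principal_in_mono HS Ss eq_a.
Qed.

Lemma unit_inM (R : idomainType) (S : set R) (a b : R) :
  is_subring S -> S a -> S b -> unit_in S (a * b) -> unit_in S a.
Proof.
move=> /is_subringP[_ _ SM] Sa Sb [_ [c Sc abc1]]; split=> //.
by exists (b * c); [exact: SM | rewrite mulrA].
Qed.

(** A nonunit that is not a product of irreducibles has a proper factor with the
same defect; iterating gives a strictly ascending chain. *)
Lemma atomic_of_ACCP (R : idomainType) (S : set R) :
  is_subring S -> ACCP S -> atomic S.
Proof.
move=> HS accS a Sa a0 nUa.
pose factors a := exists2 s : seq R,
  (forall x, x \in s -> irreducible_in S x) & a = \prod_(x <- s) x.
pose bad a := [/\ S a, a != 0, ~ unit_in S a & ~ factors a].
apply: contrapT => nfa; have bad_a : bad a by [].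
have step b : exists c, bad b -> bad c /\
    (exists d, [/\ S d, ~ unit_in S d & b = d * c]).
  case: (pselect (bad b)) => [bad_b|]; last by exists 0.
  have [Sb b0 nUb nfb] := bad_b.
  have nirr : ~ irreducible_in S b.
    move=> irr; apply: nfb; exists [:: b]; last by rewrite big_seq1.
    by move=> x; rewrite inE => /eqP->.
  have [c [d [Sc Sd bcd nUc nUd]]] : exists c d,
      [/\ S c, S d, b = c * d, ~ unit_in S c & ~ unit_in S d].
    apply: contrapT => nex; apply: nirr; split=> // c d Sc Sd bcd.
    have [|nUc] := pselect (unit_in S c); first by left.
    have [|nUd] := pselect (unit_in S d); first by right.
    by case: nex; exists c, d.
  have c0 : c != 0 by apply: contraNneq b0 => c0; rewrite bcd c0 mul0r.
  have d0 : d != 0 by apply: contraNneq b0 => d0; rewrite bcd d0 mulr0.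
  have [[s irr_s eq_c]|nfc] := pselect (factors c).
    have [[t irr_t eq_d]|nfd] := pselect (factors d).
      case: nfb; exists (s ++ t); last by rewrite big_cat /= -eq_c -eq_d.
      by move=> x; rewrite mem_cat => /orP[/irr_s|/irr_t].
    by exists d => _; split=> //; exists c.
  by exists c => _; split=> //; exists d; rewrite mulrC.
have [f fP] := choice step.
pose u n := iter n f a.
have bad_u n : bad (u n) by elim: n => //= n /fP[].
have [||N stab] := accS u.
- by move=> n; have [] := bad_u n.
- move=> n; have [_ [d [Sd _ ud]]] := fP _ (bad_u n).
  exact: principal_in_mono HS Sd ud.
have [_ [d [Sd nUd ud]]] := fP _ (bad_u N).
have [_ uN0 _ _] := bad_u N.
case: nUd; split=> //.
have [s Ss us] : principal_in S (u N) (u N.+1).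
  by rewrite -(stab N.+1 (leqnSn N)); exact: principal_in_self.
exists s => //; apply: (mulIf uN0); rewrite mul1r -mulrA us; exact: esym ud.
Qed.

Lemma hereditarily_ACCP_atomic (R : idomainType) :
  hereditarily_ACCP R -> hereditarily_atomic R.
Proof. by move=> accR S HS; apply: atomic_of_ACCP (accR S HS). Qed.

(** The ring [A + P], where [P] is the union of the [z n * B], is not atomic: it
has [P] as a prime ideal, because [P] meets the domain [A] only in 0, and no
element of [P] is irreducible, because [z n * b] has the factor [y n].  The
latter remains a nonunit when [P] is adjoined to [A]. *)
Lemma chain_not_hereditarily_atomic (R : idomainType) (A B : set R)
    (y z : nat -> R) :
  is_subring A -> is_subring B -> A `<=` B ->
  (forall n, A (y n)) -> (forall n, ~ unit_in A (y n)) ->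
  (forall n, B (z n)) -> (forall n, z n = y n * z n.+1) -> z 0%N != 0 ->
  (forall n b, B b -> A (z n * b) -> z n * b = 0) ->
  ~ hereditarily_atomic R.
Proof.
move=> HA HB AB Ay nUy Bz zE z0 AP0 hatR.
have [A1 AsubB AM] := (is_subringP A).1 HA.
have [B1 BsubB BM] := (is_subringP B).1 HB.
have A0 : A 0 by rewrite -(subrr 1); exact: AsubB.
have B0 : B 0 by exact: AB.
have By n : B (y n) by exact: AB.
pose P : set R := [set p | exists n, exists2 b, B b & p = z n * b].
(* The ideals z n * B increase with n, so that P is directed. *)
have zD n k : exists2 c, B c & z n = z (n + k)%N * c.
  elim: k => [|k [c Bc IH]]; first by exists 1; rewrite ?addn0 ?mulr1.
  exists (y (n + k)%N * c); first exact: BM.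
  by rewrite {1}IH addnS {1}zE [y _ * _]mulrC mulrA.
have PB p q : P p -> P q -> P (p - q).
  move=> [m [b Bb ->]] [n [c Bc ->]]; exists (m + n)%N.
  have [d Bd ->] := zD m n; have [e Be ->] := zD n m.
  exists (d * b - e * c); first by apply: BsubB; exact: BM.
  by rewrite [(n + m)%N]addnC mulrBr !mulrA.
have PM b p : B b -> P p -> P (b * p).
  move=> Bb [m [c Bc ->]]; exists m, (b * c); first exact: BM.
  by rewrite mulrCA.
have P0 : P 0 by exists 0%N, 0; rewrite ?mulr0.
have PN p : P p -> P (- p) by rewrite -[- p]sub0r; exact: PB.
have PD p q : P p -> P q -> P (p + q).
  by move=> Pp /PN Pq; rewrite -[q]opprK; exact: PB.
have PsubB p : P p -> B p by move=> [m [b Bb ->]]; exact: BM.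
have AP p : A p -> P p -> p = 0.
  by move=> Ap [n [b Bb pE]]; move: Ap; rewrite pE; exact: AP0.
pose S : set R := [set s | exists a p, [/\ A a, P p & s = a + p]].
have AS : A `<=` S by move=> a Aa; exists a, 0; rewrite addr0.
have PS : P `<=` S by move=> p Pp; exists 0, p; rewrite add0r.
have HS : is_subring S.
  apply/is_subringP; split; first exact: AS.
    move=> _ _ [a [p [Aa Pp ->]]] [b [q [Ab Pq ->]]]; exists (a - b), (p - q).
    by split; [exact: AsubB|exact: PB|rewrite opprD addrACA].
  move=> _ _ [a [p [Aa Pp ->]]] [b [q [Ab Pq ->]]].
  exists (a * b), (a * q + b * p + p * q); split; first exact: AM.
    apply: (PD); last by apply: (PM) => //; exact: PsubB.
    by apply: (PD); apply: (PM) => //; exact: AB.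
  by rewrite mulrDl !mulrDr [p * b]mulrC !addrA.
have nUP p : P p -> ~ unit_in S p.
  move=> Pp [_ [_ [b [q [Ab Pq ->]]] pbq1]].
  have /eqP := oner_neq0 R; apply; apply: AP => //; rewrite -pbq1 mulrC.
  apply: (PM) => //; rewrite -[q]opprK.
  by apply: BsubB; [exact: AB|exact/PsubB/PN].
have nUyS n : ~ unit_in S (y n).
  move=> [_ [_ [b [q [Ab Pq ->]]] ybq1]]; apply: (nUy n); split=> //.
  exists b => //; apply/eqP; rewrite -subr_eq0; apply/eqP.
  apply: AP; first by apply: AsubB => //; exact: AM.
  rewrite -ybq1 mulrDr opprD addrA subrr add0r; apply: PN; exact: PM.
have redP p : P p -> ~ irreducible_in S p.
  move=> Pp [_ p0 _ irr]; have [n [b Bb pE]] := Pp.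
  have Pz : P (z n.+1 * b) by exists n.+1, b.
  have [] := irr (y n) (z n.+1 * b); rewrite ?mulrA -?zE //.
  - exact: AS.
  - exact: PS.
  - exact: nUyS.
  - exact: nUP.
have Pz0 : P (z 0%N) by exists 0%N, 1; rewrite ?mulr1.
have [s irr_s eq_z] := hatR S HS (z 0%N) (PS _ Pz0) z0 (nUP _ Pz0).
(* An irreducible element of S has a nonzero component in A, and so has a
   product of such elements. *)
have prodP (t : seq R) : (forall x, x \in t -> irreducible_in S x) ->
    exists a p, [/\ A a, P p, a != 0 & \prod_(x <- t) x = a + p].
  elim: t => [|x t IH] irr_t.
    by exists 1, 0; rewrite big_nil addr0 oner_neq0.
  have [|a [p [Aa Pp a0 tE]]] := IH.
    by move=> w wt; apply: irr_t; rewrite inE wt orbT.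
  have irr_x := irr_t x (mem_head _ _).
  have [[b [q [Ab Pq xE]]] _ _ _] := irr_x.
  exists (b * a), (b * p + a * q + q * p); split.
  - exact: AM.
  - apply: (PD); last by apply: (PM) => //; exact: PsubB.
    by apply: (PD); apply: (PM) => //; exact: AB.
  - rewrite mulf_neq0 //; apply/eqP => b0; apply: (redP x) => //.
    by rewrite xE b0 add0r.
  - by rewrite big_cons tE xE mulrDl !mulrDr [q * a]mulrC !addrA.
have [a [p [Aa Pp /eqP a0 prodE]]] := prodP s irr_s.
apply: a0; apply: AP => //.
by rewrite -[a](addrK p) -prodE -eq_z; exact: PB.
Qed.

Lemma unit_in_setT (R : idomainType) (a : R) :
  unit_in [set: R] a <-> a \is a GRing.unit.
Proof.
split=> [[_ [b _ ab1]]|Ua].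
  by apply/unitrP; exists b; rewrite mulrC ab1.
by split=> //; exists a^-1; rewrite ?divrr.
Qed.

Lemma principal_unit (R : idomainType) (a : R) :
  principal a = [set: R] <-> a \is a GRing.unit.
Proof.
split=> [eq_aR|Ua].
  have : principal a 1 by rewrite eq_aR.
  by move=> [b _ ba1]; apply/unitrP; exists b; rewrite [a * b]mulrC ba1.
apply/seteqP; split=> // b _; exists (b / a) => //.
by rewrite divrK.
Qed.

(** Any irreducible factor of [z] serves as [d], since no strictly larger proper
principal ideal exists above an irreducible element. *)
Lemma atomic_no_chain_divisor (R : idomainType) (z : R) :
  atomic [set: R] -> z != 0 -> z \isn't a GRing.unit ->
  exists2 d, exists c, z = d * c &
    [/\ d != 0, d \isn't a GRing.unit & ~ infinite_chain_from d].
Proof.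
move=> atR z0 nUz.
have nUz' : ~ unit_in [set: R] z by rewrite unit_in_setT; exact/negP.
have [s irr_s zE] := atR z I z0 nUz'.
case: s => [|d s] in irr_s zE *.
  by rewrite zE big_nil unitr1 in nUz.
have [_ d0 nUd irr_d] := irr_s d (mem_head _ _).
exists d; first by exists (\prod_(x <- s) x); rewrite zE big_cons.
split=> //; first by apply/negP; rewrite -unit_in_setT.
move=> [a [a0d aS inj_a]].
have [s0 _ a01] := (principal_inP (a 0%N) (a 1%N) (subringT R)).1 (aS 0%N).
have [t _ dE] : exists2 t, [set: R] t & d = t * a 0%N.
  apply/(principal_inP _ _ (subringT R)).
  by rewrite -[X in _ `<=` X]/(principal _) a0d.
have : unit_in setT (t * s0) \/ unit_in setT (a 1%N).
  by apply: irr_d; rewrite // dE a01 mulrA.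
case=> [Uts|Ua].
  have Us : s0 \is a GRing.unit.
    apply/unit_in_setT; rewrite mulrC in Uts.
    exact: unit_inM (subringT R) _ _ Uts.
  have /inj_a // : principal (a 0%N) = principal (a 1%N).
  apply/seteqP; split; first exact: aS.
  apply: (principal_in_mono (s := s0^-1) (subringT R)) => //.
  by rewrite a01 mulKr.
have /inj_a // : principal (a 1%N) = principal (a 2).
have a1T : principal (a 1%N) = setT by apply/principal_unit/unit_in_setT.
by apply/seteqP; split; [exact: aS|rewrite a1T].
Qed.

Lemma successive_quotients (R : idomainType) (x : R) (y : nat -> R) :
  x != 0 -> (\bigcap_n principal (\prod_(i < n.+1) y i)) x ->
  exists2 z : nat -> R, z 0%N = x & forall n, z n = y n * z n.+1.
Proof.
move=> x0 xy.
have /choice[z zP] n : exists z, x = z * \prod_(i < n) y i.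
  case: n => [|n]; first by exists x; rewrite big_ord0 mulr1.
  by have [z _ <-] := xy n I; exists z.
exists z; first by rewrite [RHS](zP 0%N) big_ord0 mulr1.
move=> n; have P0 : \prod_(i < n) y i != 0.
  by apply: contraNneq x0 => P0; rewrite (zP n) P0 mulr0.
apply: (mulIf P0); rewrite -zP {1}(zP n.+1) big_ord_recr /=.
by rewrite [_ * y n]mulrC mulrA [_ * y n]mulrC.
Qed.

(** Multiplying the integral equation of [t = s^-1], of degree [n + 1], by
[s ^ n] expresses [t] as a polynomial in [s] with coefficients in [A]. *)
Lemma integral_inv_mem (R : comNzRingType) (A S : set R) (s t : R) :
  is_subring A -> is_subring S -> A `<=` S ->
  S s -> s * t = 1 -> integral_over A t -> S t.
Proof.
move=> HA HS AS Ss st1 [p [mon_p Ap pt0]].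
have [S1 SB SM] := (is_subringP S).1 HS.
have sz_p : (1 < size p)%N.
  rewrite ltnNge; apply/negP => /size1_polyC pE.
  move: mon_p pt0; rewrite pE monicE lead_coefC => /eqP->.
  by rewrite rootC oner_eq0.
have := congr1 ( *%R (s ^+ (size p).-2)) (rootP pt0).
rewrite mulr0 horner_coef.
case sz : (size p) sz_p => [|[|n]] //= _; rewrite big_ord_recr /=.
have -> : p`_n.+1 = 1.
  by move: mon_p; rewrite monicE lead_coefE sz => /eqP.
rewrite mul1r mulrDr exprS [s ^+ n * (t * _)]mulrCA -exprMn st1 expr1n mulr1.
move=> /eqP; rewrite addrC addr_eq0 => /eqP->; rewrite mulr_sumr.
rewrite -in_setE -(in_subring_pred HS) rpredN; apply: rpred_sum => i _.
have -> : s ^+ n * (p`_i * t ^+ i) = p`_i * s ^+ (n - i).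
  rewrite mulrCA; congr (_ * _); case: i => i /= le_in.
  rewrite -[in LHS](subnK (le_in : (i <= n)%N)).
  by rewrite exprD -mulrA -exprMn st1 expr1n mulr1.
apply: rpredM; last apply: rpredX; rewrite in_subring_pred in_setE //.
by apply: AS; exact: (polyOver_setP _ (subring0 HA)).1.
Qed.

(** If [u] is a polynomial of degree less than [d] in [u^-1], multiplying by
[u ^ d] gives a monic equation of degree [d + 1] for [u]. *)
Lemma integral_of_eval_inv (R : idomainType) (A : set R) (u : R) :
  is_subring A -> u \is a GRing.unit -> eval_ring A u^-1 u -> integral_over A u.
Proof.
move=> HA Uu [p Ap pu].
pose d := size p; pose r := \sum_(i < d) p`_i *: 'X^(d - i).
have size_r : (size r <= d.+1)%N.
  apply: (leq_trans (size_sum _ _ _)); apply/bigmax_leqP => i _.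
  by apply: (leq_trans (size_scale_leq _ _)); rewrite size_polyXn ltnS leq_subr.
exists ('X^(d.+1) - r); split.
- rewrite monicE lead_coefDl ?lead_coefXn //.
  by rewrite size_polyN size_polyXn ltnS.
- change ('X^(d.+1) - r \is a @polyOver R (subring_pred HA)).
  rewrite rpredB ?rpredX ?polyOverX //; apply: rpred_sum => i _.
  apply: polyOverZ; last by rewrite rpredX ?polyOverX.
  by apply: mem_set; exact: (polyOver_setP _ (subring0 HA)).1.
- rewrite rootE hornerD hornerN hornerXn subr_eq0 exprSr -{2}pu.
  rewrite horner_coef mulr_sumr horner_sum; apply/eqP/eq_bigr => i _.
  rewrite hornerZ hornerXn mulrCA exprVn; congr (_ * _).
  by rewrite exprB // ltnW.
Qed.

(** When a chain of [S] has become stationary in [R], each later generator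
differs from the limit one by a factor in [S] that is a unit of [R]; the chain
is stationary in [S] as soon as the inverse of that factor lies in [S]. *)
Lemma ACCP_subring (R : idomainType) (S : set R) :
  is_subring S -> ACCP [set: R] ->
  (forall s t, S s -> s * t = 1 -> S t) -> ACCP S.
Proof.
move=> HS accR SV a Sa aS.
have [S1 SB SM] := (is_subringP S).1 HS.
have step n : exists2 s, S s & a n = s * a n.+1 by apply/principal_inP.
have step_le m k : exists2 s, S s & a m = s * a (m + k)%N.
  elim: k => [|k [s Ss IH]]; first by exists 1; rewrite ?addn0 ?mul1r.
  have [t St at_] := step (m + k)%N; exists (s * t); first exact: SM.
  by rewrite {1}IH at_ addnS mulrA.
have [n|N stab] := accR a (fun=> I).
  have [s _ as_] := step n.
  exact: principal_in_mono (subringT R) _ as_.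
exists N => n le_Nn.
have [s Ss] := step_le N (n - N)%N; rewrite subnKC // => aNE.
have [r _ anE] : principal (a N) (a n).
  rewrite /principal -(stab n le_Nn); exact: principal_in_self (subringT R).
have [an0|an_neq0] := eqVneq (a n) 0; first by rewrite aNE an0 mulr0.
have sr1 : s * r = 1.
  by apply: (mulIf an_neq0); rewrite mul1r mulrAC -aNE mulrC.
apply/seteqP; split; last exact: principal_in_mono HS Ss aNE.
exact: principal_in_mono HS (SV s r Ss sr1) (esym anE).
Qed.

Lemma hereditarily_ACCP_integral_units (R : idomainType) :
  ACCP [set: R] ->
  (forall u : R, u \is a GRing.unit -> integral_over (prime_subring R) u) ->
  hereditarily_ACCP R.
Proof.
move=> accR intU S HS; apply: ACCP_subring => // s t Ss st1.
apply: (integral_inv_mem (@prime_subring_subring R) HS (prime_subring_sub HS)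
  Ss st1).
apply: intU.
by apply/unitrP; exists s; rewrite [t * s]mulrC.
Qed.

Lemma ACCP_field (R : idomainType) (S : set R) :
  is_subring S -> (forall s, S s -> s != 0 -> unit_in S s) -> ACCP S.
Proof.
move=> HS fS a Sa aS; have [S1 SB SM] := (is_subringP S).1 HS.
have prinS s : S s -> s != 0 -> principal_in S s = S.
  move=> Ss /(fS s Ss)[_ [t St st1]]; apply/seteqP; split=> x.
    by move=> [r Sr <-]; exact: SM.
  move=> Sx; exists (x * t); first exact: SM.
  by rewrite -mulrA [t * s]mulrC st1 mulr1.
have [[N aN0]|alla0] := pselect (exists N, a N != 0); last first.
  have a0 n : a n = 0 by apply/eqP; apply: contra_notT alla0 => ?; exists n.
  by exists 0%N => n _; rewrite !a0.
exists N => n /subnKC <-; elim: (n - N)%N => [|k IH]; first by rewrite addn0.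
rewrite addnS.
have subk : S `<=` principal_in S (a (N + k).+1).
  by apply: subset_trans (aS _); rewrite IH prinS.
suff ak0 : a (N + k).+1 != 0 by rewrite (prinS (a _)) // (prinS (a N)).
apply/eqP => ak0.
have [r _] := subk 1 S1; rewrite ak0 mulr0 => /eqP.
by rewrite eq_sym oner_eq0.
Qed.

(** * Algebraic elements over subfields given as sets *)

Lemma is_subfieldP (K : fieldType) (F : set K) :
  is_subfield F <->
  [/\ F 1, forall a b, F a -> F b -> F (a - b)
         & forall a b, F a -> F b -> F (a / b)].
Proof.
split=> -[F1 FB FV].
  split=> [|a b Fa Fb|a b Fa Fb]; first by rewrite -in_setE.
    by rewrite -in_setE; apply: FB; rewrite in_setE.
  by rewrite -in_setE; apply: FV; rewrite in_setE.
split=> [|a b|a b]; first by rewrite in_setE.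
  by rewrite !in_setE; apply: FB.
by rewrite !in_setE; apply: FV.
Qed.

Lemma subfield_subring (K : fieldType) (F : set K) :
  is_subfield F -> is_subring F.
Proof. exact: GRing.divring_closedBM. Qed.

Lemma subfield0 (K : fieldType) (F : set K) : is_subfield F -> F 0.
Proof. by move/subfield_subring/subring0. Qed.

Lemma subfieldV (K : fieldType) (F : set K) (a : K) :
  is_subfield F -> F a -> F a^-1.
Proof. by case/is_subfieldP=> F1 _ FV Fa; rewrite -[a^-1]mul1r; exact: FV. Qed.

Lemma field_adjoin_subfield (K : fieldType) (F A : set K) :
  is_subfield (field_adjoin F A).
Proof.
apply/is_subfieldP; split=> [|a b Fa Fb|a b Fa Fb] T [HT sT];
  have [T1 TB TV] := (is_subfieldP T).1 HT => //.
- by apply: TB; [apply: Fa|apply: Fb].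
- by apply: TV; [apply: Fa|apply: Fb].
Qed.

Lemma field_adjoin_base (K : fieldType) (F A : set K) : F `<=` field_adjoin F A.
Proof. by move=> a Fa T [_]; apply; left. Qed.

Lemma field_adjoin_gen (K : fieldType) (F A : set K) : A `<=` field_adjoin F A.
Proof. by move=> a Aa T [_]; apply; right. Qed.

Lemma field_adjoin_min (K : fieldType) (F A T : set K) :
  is_subfield T -> F `<=` T -> A `<=` T -> field_adjoin F A `<=` T.
Proof. by move=> HT FT AT a; apply; split=> // b [/FT|/AT]. Qed.

Definition subfield_pred (K : fieldType) (F : set K) of is_subfield F :
  {pred K} := mem F.

HB.instance Definition _ (K : fieldType) (F : set K) (HF : is_subfield F) :=
  GRing.isDivringClosed.Build K (subfield_pred HF) HF.

(** Turning the set [F] into a field type gives access to the theory of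
algebraic elements over a field embedding. *)
Record subfield_type (K : fieldType) (F : set K) (HF : is_subfield F) :=
  SubfieldType { subfield_val :> K; _ : subfield_val \in subfield_pred HF }.

Section SubfieldType.
Variables (K : fieldType) (F : set K) (HF : is_subfield F).
HB.instance Definition _ := [isSub for @subfield_val K F HF].
HB.instance Definition _ := [Choice of subfield_type HF by <:].
HB.instance Definition _ :=
  [SubChoice_isSubIntegralDomain of subfield_type HF by <:].
HB.instance Definition _ :=
  [SubIntegralDomain_isSubField of subfield_type HF by <:].
End SubfieldType.

Lemma algebraic_overP (K : fieldType) (F : set K) (HF : is_subfield F) (x : K) :
  algebraic_over F x <-> algebraicOver (val : subfield_type HF -> K) x.
Proof.
split=> [[p [p0 Fp px0]]|[p p0 px0]]; last first.
  exists (map_poly val p); split=> //; first by rewrite map_poly_eq0.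
  apply/polyOver_setP; first exact: subfield0.
  by move=> i; rewrite coef_map -in_setE; exact: valP.
have Fpi := (polyOver_setP _ (subfield0 HF)).1 Fp.
pose q : {poly subfield_type HF} := \poly_(i < size p) insubd 0 p`_i.
have qE : map_poly val q = p.
  apply/polyP=> i; rewrite coef_map coef_poly.
  case: ltnP => [lt_ip|le_pi]; last by rewrite nth_default.
  rewrite /= val_insubd ifT // /subfield_pred /=.
  exact: mem_set.
by exists q; rewrite ?qE // -(map_poly_eq0 val) qE.
Qed.

Lemma algebraic_subfield (K : fieldType) (F : set K) :
  is_subfield F -> is_subfield (algebraic_over F).
Proof.
move=> HF; apply/is_subfieldP.
split=> [|a b|a b]; rewrite !(algebraic_overP HF).
- exact: algebraic1.
- exact: algebraic_sub.
- exact: algebraic_div.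
Qed.

Lemma algebraic_base (K : fieldType) (F : set K) :
  is_subfield F -> F `<=` algebraic_over F.
Proof.
move=> HF a Fa; exists ('X - a%:P); split.
- by rewrite polyXsubC_eq0.
- change ('X - a%:P \is a @polyOver K (subfield_pred HF)).
  by rewrite polyOverXsubC; apply: mem_set.
- by rewrite root_XsubC.
Qed.

Lemma integral_of_algebraic (K : fieldType) (F : set K) (x : K) :
  is_subfield F -> algebraic_over F x -> integral_over F x.
Proof.
move=> HF [p [p0 Fp px0]]; exists ((lead_coef p)^-1 *: p); split.
- by rewrite monicE lead_coefZ mulVf // lead_coef_eq0.
- have F0 := subfield0 HF; apply/polyOver_setP => // i.
  have Fpi := (polyOver_setP _ F0).1 Fp.
  have /is_subfieldP[_ _ FV] := HF.
  by rewrite coefZ mulrC; apply: FV; exact: Fpi.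
- by rewrite rootE hornerZ (rootP px0) mulr0.
Qed.

Lemma algebraic_trans (K : fieldType) (F G : set K) :
  is_subfield F -> is_subfield G -> G `<=` algebraic_over F ->
  algebraic_over G `<=` algebraic_over F.
Proof.
move=> HF HG GF x [p [p0 Gp px0]].
apply/(algebraic_overP HF)/integral_algebraic.
apply: (integral_root p0 px0) => a pa; apply/integral_algebraic/algebraic_overP.
by apply: GF; rewrite -in_setE; have /allP := Gp; apply.
Qed.

(** * Exchange property and transcendence degree *)

Definition coefs_in (K : fieldType) (F : set K) (P : {poly {poly K}}) : Prop :=
  forall i j, F P`_i`_j.

Lemma adjoin1_fraction (K : fieldType) (F : set K) (x a : K) :
  is_subfield F -> field_adjoin F [set x] a ->
  exists f g : {poly K}, [/\ f \is a polyOver (mem F), g \is a polyOver (mem F),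
                             g.[x] != 0 & a = f.[x] / g.[x]].
Proof.
move=> HF; move: a; pose G : set K := [set a | exists f g : {poly K},
  [/\ f \is a polyOver (mem F), g \is a polyOver (mem F),
      g.[x] != 0 & a = f.[x] / g.[x]]].
rewrite -/(_ `<=` G).
have pF (f : {poly K}) :
  (f \is a polyOver (mem F)) = (f \is a polyOver (subfield_pred HF)) by [].
suff HG : is_subfield G.
  apply: field_adjoin_min => //.
    move=> b Fb; exists b%:P, 1; rewrite !hornerE oner_eq0 divr1; split=> //.
      by rewrite pF polyOverC; apply: mem_set.
    by rewrite pF; exact: rpred1.
  move=> _ ->; exists 'X, 1; rewrite !hornerE oner_eq0 divr1; split=> //.
    by rewrite pF polyOverX.
  by rewrite pF; exact: rpred1.
apply/is_subfieldP; split.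
- exists 1, 1; rewrite !hornerC oner_eq0 mulfV ?oner_eq0 //.
  by split=> //; rewrite pF; exact: rpred1.
- move=> _ _ [f [g [Ff Fg g0 ->]]] [h [k [Fh Fk k0 ->]]].
  exists (f * k - h * g), (g * k); split.
  + by rewrite pF; apply: rpredB; apply: rpredM.
  + by rewrite pF; apply: rpredM.
  + by rewrite hornerM mulf_neq0.
  + by rewrite !(hornerD, hornerN, hornerM) -mulNr addf_div // mulNr.
- move=> _ _ [f [g [Ff Fg g0 ->]]] [h [k [Fh Fk k0 ->]]].
  have [h0|h0] := eqVneq h.[x] 0.
    exists 0, 1; rewrite h0 mul0r invr0 mulr0 !hornerC ?mul0r oner_eq0.
    by split=> //; rewrite pF ?rpred0 ?rpred1.
  exists (f * k), (g * h); split.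
  + by rewrite pF; apply: rpredM.
  + by rewrite pF; apply: rpredM.
  + by rewrite hornerM mulf_neq0.
  + by rewrite !hornerM invf_div mulf_div.
Qed.

(** Clearing denominators: the coefficients of an equation of [y] over [F(x)]
are fractions of polynomials evaluated at [x]. The outer variable of [P] stands
for [y] and the inner one for [x]. *)
Lemma algebraic_adjoin1 (K : fieldType) (F : set K) (x y : K) :
  is_subfield F -> algebraic_over (field_adjoin F [set x]) y ->
  exists2 P : {poly {poly K}}, coefs_in F P &
    map_poly (horner_eval x) P != 0 /\ root (map_poly (horner_eval x) P) y.
Proof.
move=> HF [p [p0 Fp py0]].
have F0 := subfield0 HF.
have HFx := field_adjoin_subfield F [set x].
have Fxi := (polyOver_setP _ (subfield0 HFx)).1 Fp.
have /choice[fg fgP] i : exists fg : {poly K} * {poly K},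
    [/\ fg.1 \is a polyOver (mem F), fg.2 \is a polyOver (mem F),
        fg.2.[x] != 0 & p`_i = fg.1.[x] / fg.2.[x]].
  by have [f [g ?]] := adjoin1_fraction HF (Fxi i); exists (f, g).
pose D := \prod_(j < size p) (fg j).2.
(* The coefficient of index i of D.[x] *: p, before evaluation at x. *)
pose c (i : nat) := (fg i).1 * \prod_(j < size p | j != i :> nat) (fg j).2.
have pF (f : {poly K}) :
  (f \is a polyOver (mem F)) = (f \is a polyOver (subfield_pred HF)) by [].
have PE : map_poly (horner_eval x) (\poly_(i < size p) c i) = D.[x] *: p.
  apply/polyP=> i; rewrite coef_map coef_poly coefZ.
  case: ltnP => [lt_ip|le_pi]; last first.
    by rewrite nth_default // mulr0 /= /horner_eval horner0.
  have [_ _ g0 ->] := fgP i.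
  rewrite /= /horner_eval /c /D [in RHS](bigD1 (Ordinal lt_ip)) //= !hornerM.
  by rewrite [RHS]mulrCA; congr (_ * _); rewrite mulrAC divff // mul1r.
exists (\poly_(i < size p) c i).
  move=> i j; rewrite coef_poly; case: ifP => _; last by rewrite coef0.
  apply: (polyOver_setP _ F0).1; rewrite pF; apply: rpredM.
    by rewrite -pF; have [] := fgP i.
  by apply: rpred_prod => k _; rewrite -pF; have [] := fgP k.
rewrite PE; have D0 : D.[x] != 0.
  rewrite /D horner_prod; apply/prodf_neq0 => k _; by have [] := fgP k.
by rewrite scaler_eq0 negb_or D0 p0 rootZ.
Qed.

(** A relation between [x] and [y] that is nontrivial in [y] can be read as an
equation for [x]. It stays nontrivial at [y], as otherwise each of
its nonzero coefficients would be an equation of [y] over [F]. *)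
Lemma algebraic_exchange (K : fieldType) (F : set K) (x y : K) :
  is_subfield F -> algebraic_over (field_adjoin F [set x]) y ->
  ~ algebraic_over F y -> algebraic_over (field_adjoin F [set y]) x.
Proof.
move=> HF /(algebraic_adjoin1 HF)[P FP [P0 Py0]] ntry.
have F0 := subfield0 HF.
pose Q := swapXY P.
have Q0 : Q != 0.
  by rewrite swapXY_eq0; apply: contraNneq P0 => ->; rewrite rmorph0.
have FQ : coefs_in F Q by move=> i j; rewrite coef_swapXY.
have evQ i : (map_poly (horner_eval y) Q)`_i = (Q`_i).[y] by rewrite coef_map.
exists (map_poly (horner_eval y) Q); split.
- apply/eqP => Qy0; apply: ntry; exists (lead_coef Q); split.
  + by rewrite lead_coef_eq0.
  + by apply/polyOver_setP => // j; exact: FQ.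
  + by rewrite rootE lead_coefE -evQ Qy0 coef0.
- have HFy := field_adjoin_subfield F [set y].
  apply/polyOver_setP; first exact: subfield0.
  move=> i; rewrite evQ.
  apply: (eval_ring_min (subfield_subring HFy)
    (@field_adjoin_base _ F [set y])).
    exact: field_adjoin_gen.
  by exists Q`_i => //; apply/polyOver_setP => // j; exact: FQ.
- have -> : map_poly (horner_eval y) Q = P.[y%:P].
    by rewrite -horner_swapXY swapXYK.
  by move: Py0; rewrite !rootE -horner_swapXY horner2_swapXY.
Qed.

(** If [y1] is transcendental over [F], then [x] is algebraic over [F(y1)] by
exchange, hence so is [y2] by transitivity. *)
Lemma algebraic_adjoin1_dependent (K : fieldType) (F : set K) (x y1 y2 : K) :
  is_subfield F -> algebraic_over (field_adjoin F [set x]) y1 ->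
  algebraic_over (field_adjoin F [set x]) y2 ->
  exists P : {poly {poly K}}, [/\ P != 0, coefs_in F P & P.[y2, y1] = 0].
Proof.
move=> HF alg1 alg2; have F0 := subfield0 HF.
have [[p [p0 Fp py1]]|tr1] := pselect (algebraic_over F y1).
  exists p%:P; split; first by rewrite polyC_eq0.
    move=> i j; rewrite coefC; case: eqP => _; last by rewrite coef0.
    exact: (polyOver_setP _ F0).1.
  by rewrite hornerC; exact/rootP.
have HF1 := field_adjoin_subfield F [set y1].
have xalg := algebraic_exchange HF alg1 tr1.
have alg21 : algebraic_over (field_adjoin F [set y1]) y2.
  apply: (algebraic_trans HF1 (field_adjoin_subfield F [set x])) => //.
  apply: field_adjoin_min; first exact: algebraic_subfield.
    by move=> a Fa; apply: algebraic_base => //; exact: field_adjoin_base.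
  by move=> _ ->.
have [P FP [P0 Py]] := algebraic_adjoin1 HF alg21.
exists P; split=> //; first by apply: contraNneq P0 => ->; rewrite rmorph0.
by move: Py; rewrite rootE -horner_swapXY horner2_swapXY => /eqP.
Qed.

(** Algebraic independence is phrased with multivariate polynomials and the
exchange argument with iterated ones; the two are matched here in two
variables. *)
Lemma algebraically_independent2 (K : fieldType) (F B : set K) (b1 b2 : K)
    (P : {poly {poly K}}) :
  is_subfield F -> algebraically_independent F B -> B b1 -> B b2 -> b1 != b2 ->
  coefs_in F P -> P.[b2, b1] = 0 -> P = 0.
Proof.
move=> HF indB Bb1 Bb2 neq_b FP Pb0.
pose b (i : 'I_2) := if i == 0 then b1 else b2.
have inj_b : injective b.
  move=> i j; rewrite /b.
  case: (eqVneq i 0) => [->|i0]; case: (eqVneq j 0) => [->|j0] //.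
  - by move=> bE; rewrite bE eqxx in neq_b.
  - by move=> bE; rewrite bE eqxx in neq_b.
  - move=> _; case: i i0 => [[|[|]]] //= ? _.
    by case: j j0 => [[|[|]]] //= ? _; apply: val_inj.
pose p : {mpoly K[2]} :=
  \sum_(i < size P) \sum_(j < size P`_i) P`_i`_j *: ('X_0 ^+ j * 'X_1 ^+ i).
have p0 : p = 0.
  apply: (indB _ b) => //.
  - by move=> i; rewrite /b; case: ifP.
  - change (p \is a mpolyOver 2 (subfield_pred HF)).
    apply: rpred_sum => i _; apply: rpred_sum => j _.
    apply: mpolyOverZ; first by apply: mem_set; exact: FP.
    by rewrite rpredM ?rpredX // mpolyOverX.
  - rewrite -[RHS]Pb0 /p raddf_sum [P.[_]]horner_coef horner_sum.
    apply: eq_bigr => i _.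
    rewrite -polyC_exp hornerM hornerC horner_coef raddf_sum mulr_suml.
    apply: eq_bigr => j _.
    by rewrite /= mevalZ mevalM !rmorphXn /= !mevalXU /b /= mulrA.
pose h (i : 'I_2) : {poly {poly K}} := if i == 0 then 'X%:P else 'X.
(* Substituting the two variables of P for those of p gives P back. *)
have := congr1 (mmap (polyC \o polyC) h) p0; rewrite rmorph0 => <-.
rewrite -[LHS]coefK poly_def /p raddf_sum; apply: eq_bigr => i _.
rewrite -mul_polyC -{1}[P`_i]coefK poly_def !raddf_sum mulr_suml.
apply: eq_bigr => j _.
rewrite /= mmapZ rmorphM !rmorphXn /= !mmapX !mmap1U /h /=.
by rewrite -mul_polyC rmorphM rmorphXn /= mulrA.
Qed.

(** An injective family in a singleton has at most one index, so a monomial in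
it is determined by its degree and the polynomial is univariate in disguise. *)
Lemma algebraically_independent1 (K : fieldType) (F : set K) (u : K) :
  is_subfield F -> transcendental_over F u ->
  algebraically_independent F [set u].
Proof.
move=> HF tru n b inj_b ub p Fp pb0.
have subsingle (i j : 'I_n) : i = j by apply: inj_b; rewrite !ub.
have bE : b = fun=> u by apply/funext => i; rewrite ub.
pose q : {poly K} := \sum_(m <- msupp p) p@_m *: 'X^(mdeg m).
have qu : q.[u] = 0.
  rewrite -pb0 mevalE horner_sum; apply: eq_bigr => m _.
  rewrite hornerZ hornerXn bE; congr (_ * _).
  by rewrite prodrXr mdegE.
have inj_deg (m m' : 'X_{1..n}) : mdeg m = mdeg m' -> m = m'.
  rewrite !mdegE => eq_m; apply/mnmP => i.
  by move: eq_m; rewrite !(big_pred1 i) // => j; apply/esym/eqP.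
have qE m : q`_(mdeg m) = p@_m.
  rewrite coef_sum; have [pm|npm] := boolP (m \in msupp p).
    rewrite (bigD1_seq m) //= coefZ coefXn eqxx mulr1 big1 ?addr0 // => k neq.
    rewrite coefZ coefXn; case: eqP => [/inj_deg mk|_]; last by rewrite mulr0.
    by rewrite mk eqxx in neq.
  rewrite big_seq big1; first by apply/esym/memN_msupp_eq0.
  move=> k pk; rewrite coefZ coefXn.
  case: eqP => [/inj_deg mk|_]; last by rewrite mulr0.
  by rewrite mk pk in npm.
have q0 : q = 0.
  apply: contrapT => /eqP q0; apply: tru.
  exists q; split=> //; last exact/rootP.
  change (q \is a polyOver (subfield_pred HF)).
  apply: rpred_sum => m _.
  apply: polyOverZ; last by rewrite rpredX // polyOverX.
  by have /mpolyOverP := (Fp : p \is a mpolyOver n (subfield_pred HF)); apply.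
by apply/mpolyP => m; rewrite -qE q0 coef0 mcoeff0.
Qed.

Lemma trdeg_ge2_transcendental (K : fieldType) (F : set K) (u : K) :
  is_subfield F -> trdeg_ge F 2 ->
  exists x, transcendental_over (field_adjoin F [set u]) x.
Proof.
move=> HF [B [indB _] leB]; apply: contrapT => nex.
have alg x : algebraic_over (field_adjoin F [set u]) x.
  by apply: contrapT => trx; apply: nex; exists x.
have [b1 [b2 [Bb1 Bb2 neq_b]]] : exists b1 b2, [/\ B b1, B b2 & b1 != b2].
  move: leB => /card_leP[f].
  have I0 : 0%N \in `I_2 by apply: mem_set.
  have I1 : 1%N \in `I_2 by apply: mem_set.
  exists (val (f (SigSub I0))), (val (f (SigSub I1))).
  split; [exact: set_valP|exact: set_valP|apply/eqP => /val_inj fE].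
  by have /(congr1 val) := 'inj_f (mem_set I) (mem_set I) fE.
have [P [/eqP P0 FP Pb]] := algebraic_adjoin1_dependent HF (alg b1) (alg b2).
exact: P0 (algebraically_independent2 HF indB Bb1 Bb2 neq_b FP Pb).
Qed.

(** * The fraction field and its prime subfield *)

Lemma fractionP (R : idomainType) (x : {fraction R}) :
  exists a b : R, b != 0 /\ x = tofrac a / tofrac b.
Proof.
elim/quotW: x => r; exists (frac r).1, (frac r).2.
split; first exact: denom_ratioP.
have d0 : tofrac (frac r).2 != 0 by rewrite tofrac_eq0; exact: denom_ratioP.
apply: (mulIf d0); rewrite divfK //.
unlock FracField.tofrac; rewrite -[LHS]FracField.pi_mul; apply/eqmodP.
rewrite /= FracField.equivfE /FracField.mulf.
by rewrite !numden_Ratio ?mulf_neq0 ?oner_neq0 ?denom_ratioP // !mulr1 mulrC.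
Qed.

Lemma tofrac_inj (R : idomainType) : injective (@tofrac R).
Proof. by move=> a b /eqP; rewrite tofrac_eq => /eqP. Qed.

Lemma algebraic_fraction (R : idomainType) (F : set {fraction R}) :
  is_subfield F -> (forall a : R, algebraic_over F (tofrac a)) ->
  forall x, algebraic_over F x.
Proof.
move=> HF algR x; have [a [b [_ ->]]] := fractionP x.
by have [_ _ FV] := (is_subfieldP _).1 (algebraic_subfield HF); exact: FV.
Qed.

Lemma transcendental_fraction (R : idomainType) (F : set {fraction R}) :
  is_subfield F -> (exists x, transcendental_over F x) ->
  exists x : R, transcendental_over F (tofrac x).
Proof.
move=> HF [x trx]; apply: contrapT => nex; apply: trx.
apply: algebraic_fraction => // a; apply: contrapT => tra.
by apply: nex; exists a.
Qed.

Lemma prime_quotient_subfield (R : idomainType) :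
  is_subfield (prime_quotient_field R).
Proof.
have [Z1 ZB ZM] := (is_subringP _).1 (@prime_subring_subring R).
have tf0 (a : R) : a != 0 -> tofrac a != 0 by rewrite tofrac_eq0.
apply/is_subfieldP; split.
- exists 1 => //; exists 1; first by split=> //; apply/eqP/oner_neq0.
  by rewrite tofrac1 divr1.
- move=> _ _ [a Za [b [Zb /eqP b0] <-]] [c Zc [d [Zd /eqP d0] <-]].
  exists (a * d - c * b); first by apply: ZB; exact: ZM.
  exists (b * d); first by split; [exact: ZM|apply/eqP; rewrite mulf_neq0].
  by rewrite tofracB !tofracM -[in RHS]mulNr addf_div ?tf0 // mulNr.
- move=> _ _ [a Za [b [Zb /eqP b0] <-]] [c Zc [d [Zd /eqP d0] <-]].
  have [->|c0] := eqVneq c 0.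
    exists 0; first exact: subring0 (@prime_subring_subring R).
    exists 1; first by split=> //; apply/eqP/oner_neq0.
    by rewrite tofrac0 !mul0r invr0 mulr0.
  exists (a * d); first exact: ZM.
  exists (b * c); first by split; [exact: ZM|apply/eqP; rewrite mulf_neq0].
  by rewrite !tofracM invf_div mulf_div.
Qed.

Lemma tofrac_prime_subring (R : idomainType) (a : R) :
  prime_subring R a -> prime_quotient_field R (tofrac a).
Proof.
move=> Za; exists a => //; exists 1; last by rewrite tofrac1 divr1.
split; last by apply/eqP/oner_neq0.
by have /is_subringP[] := @prime_subring_subring R.
Qed.

(** The Frobenius map fixes the prime subring, so that [b ^ (p - 2)] is an
inverse there of a nonzero [b]. *)
Lemma prime_quotient_pchar (R : idomainType) :
  positive_char {fraction R} ->
  prime_quotient_field R `<=` [set tofrac a | a in prime_subring R].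
Proof.
move=> [p pcharK].
have pcharR : p \in [pchar R].
  rewrite inE (pcharf_prime pcharK) /= -tofrac_eq0 rmorph_nat.
  by rewrite (pcharf0 pcharK).
have HZ := @prime_subring_subring R.
have ZX (b : R) k : prime_subring R b -> prime_subring R (b ^+ k).
  move=> Zb; rewrite -in_setE -(in_subring_pred HZ); apply: rpredX.
  exact: mem_set.
move=> _ [a Za [b [Zb /eqP b0] <-]]; exists (a * b ^+ p.-2).
  by have /is_subringP[_ _] := HZ; apply=> //; exact: ZX.
have bp : b ^+ p = b.
  by move: Zb => [n _ <-]; rewrite -(pFrobenius_autE pcharR) rmorph_int.
have b_inv : b * b ^+ p.-2 = 1.
  apply: (mulfI b0); rewrite mulr1 -!exprS -[RHS]bp; congr (_ ^+ _).
  by case: (p) (pcharf_prime pcharK) => [|[]].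
rewrite tofracM; congr (_ * _); apply: (mulfI (_ : tofrac b != 0)).
  by rewrite tofrac_eq0.
by rewrite -tofracM b_inv tofrac1 divff // tofrac_eq0.
Qed.

Lemma integral_over_pchar (R : idomainType) (u : R) :
  positive_char {fraction R} ->
  algebraic_over (prime_quotient_field R) (tofrac u) ->
  integral_over (prime_subring R) u.
Proof.
move=> pcharK /(integral_of_algebraic (prime_quotient_subfield R)).
move=> [q [mon_q Qq qu0]].
have HZ := @prime_subring_subring R.
have Qqi := (polyOver_setP _ (subfield0 (prime_quotient_subfield R))).1 Qq.
have /choice[c cP] i : exists c, prime_subring R c /\ tofrac c = q`_i.
  by have [a Za <-] := prime_quotient_pchar pcharK (Qqi i); exists a.
exists (\poly_(i < size q) c i).
have qE : map_poly (@tofrac R) (\poly_(i < size q) c i) = q.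
  apply/polyP=> i; rewrite coef_map coef_poly.
  case: ltnP => [_|le_qi]; last by rewrite nth_default //= tofrac0.
  by have [_] := cP i.
split.
- apply/eqP/(@tofrac_inj R).
  rewrite -lead_coef_map_inj ?qE ?tofrac0 //; last exact: tofrac_inj.
  by rewrite tofrac1; exact/eqP.
- apply/polyOver_setP; first exact: subring0.
  move=> i; rewrite coef_poly; case: ifP => _; last exact: subring0.
  by have [] := cP i.
- apply/rootP/(@tofrac_inj R); rewrite -horner_map qE (rootP qu0).
  by rewrite tofrac0.
Qed.

Lemma subfield_preimage_subring (R : idomainType) (F : set {fraction R}) :
  is_subfield F -> is_subring (@tofrac R @^-1` F).
Proof.
move=> /subfield_subring/is_subringP[F1 FB FM].
apply/is_subringP; split=> [|a b|a b]; rewrite /preimage /=.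
- by rewrite tofrac1.
- by rewrite tofracB; exact: FB.
- by rewrite tofracM; exact: FM.
Qed.

(** * Rings that are not hereditarily atomic *)

Lemma transcendental_poly_eq0 (R : idomainType) (A : set R)
    (F : set {fraction R}) (w : R) (p : {poly R}) :
  is_subring A -> is_subfield F -> A `<=` @tofrac R @^-1` F ->
  transcendental_over F (tofrac w) ->
  p \is a polyOver (mem A) -> p.[w] = 0 -> p = 0.
Proof.
move=> HA HF AF trw Ap pw0; apply: contrapT => /eqP p0; apply: trw.
exists (map_poly (@tofrac R) p); split.
- rewrite -size_poly_eq0 size_map_inj_poly ?size_poly_eq0 //.
  exact: tofrac_inj.
- apply/polyOver_setP; first exact: subfield0.
  move=> i; rewrite coef_map; apply: AF.
  exact: (polyOver_setP _ (subring0 HA)).1.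
- by rewrite rootE horner_map pw0 /= tofrac0.
Qed.

(** Here [B] is the union of the increasing rings [A[z n]]. Every [z n] is
transcendental over [F], because [z 0] is a multiple of it by an element of [A];
so a polynomial in [z n] without constant term can only lie in [A] if it is
zero. *)
Lemma transcendental_not_hereditarily_atomic (R : idomainType) (A : set R)
    (F : set {fraction R}) (y z : nat -> R) :
  is_subring A -> is_subfield F -> A `<=` @tofrac R @^-1` F ->
  (forall n, A (y n)) -> (forall n, ~ unit_in A (y n)) ->
  (forall n, z n = y n * z n.+1) -> transcendental_over F (tofrac (z 0%N)) ->
  ~ hereditarily_atomic R.
Proof.
move=> HA HF AF Ay nUy zE trz0.
have [A1 AB AM] := (is_subringP A).1 HA.
have zD n k : exists2 c, A c & z n = c * z (n + k)%N.
  elim: k => [|k [c Ac IH]]; first by exists 1; rewrite ?addn0 ?mul1r.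
  exists (c * y (n + k)%N); first exact: AM.
  by rewrite {1}IH addnS {1}zE mulrA.
have trz n : transcendental_over F (tofrac (z n)).
  move=> algz; apply: trz0; have [c Ac] := zD 0%N n; rewrite add0n => ->.
  have HaF := subfield_subring (algebraic_subfield HF).
  have [_ _ aM] := (is_subringP _).1 HaF.
  rewrite tofracM; apply: aM; last exact: algz.
  by apply: (algebraic_base HF); exact: AF.
pose B := \bigcup_n eval_ring A (z n).
have eval_mono n k : eval_ring A (z n) `<=` eval_ring A (z (n + k)%N).
  apply: eval_ring_min; [exact: eval_ring_subring|exact: eval_ring_sub|].
  have [c Ac ->] := zD n k.
  have /is_subringP[_ _] := eval_ring_subring (z (n + k)%N) HA; apply.
    exact: eval_ring_sub.
  exact: eval_ring_gen.
have common a b : B a -> B b -> exists n,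
    eval_ring A (z n) a /\ eval_ring A (z n) b.
  move=> [m _ am] [n _ bn]; exists (m + n)%N; split; first exact: eval_mono.
  by rewrite addnC; exact: eval_mono.
have HB : is_subring B.
  apply/is_subringP; split.
  - by exists 0%N => //; apply: eval_ring_sub.
  - move=> a b Ba Bb; have [n [an bn]] := common a b Ba Bb; exists n => //.
    by have /is_subringP[_ eB _] := eval_ring_subring (z n) HA; exact: eB.
  - move=> a b Ba Bb; have [n [an bn]] := common a b Ba Bb; exists n => //.
    by have /is_subringP[_ _] := eval_ring_subring (z n) HA; apply.
apply: (chain_not_hereditarily_atomic HA HB _ Ay nUy _ zE).
- by move=> a Aa; exists 0%N => //; exact: eval_ring_sub.
- by move=> n; exists n => //; exact: eval_ring_gen.
- apply/eqP => z00; apply: trz0; rewrite z00 tofrac0.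
  by apply: algebraic_base => //; exact: subfield0.
move=> n b [m _ bm].
have [c Ac zn] := zD n m.
have [p Ap pb] : eval_ring A (z (n + m)%N) b by rewrite addnC; exact: eval_mono.
rewrite -pb zn; set w := z (n + m)%N => Aw.
(* The left summand takes at w the value z n * b, supposed to lie in A, and has
   no constant term. *)
pose q := c%:P * 'X * p - (c * w * p.[w])%:P.
have q0 : q = 0.
  apply: (transcendental_poly_eq0 HA HF AF (trz (n + m)%N)).
    change (q \is a polyOver (subring_pred HA)).
    rewrite rpredB ?rpredM ?polyOverX ?polyOverC //; exact: mem_set.
  by rewrite /q !hornerE subrr.
have /(congr1 (coefp 0)) := q0.
rewrite /= coefB coefC /= mulrAC coefMX /= sub0r coef0 => /eqP.
by rewrite oppr_eq0 => /eqP.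
Qed.

(** In [A = Z[u^-1]] the element [u^-1] is a nonunit, and it divides all the
[u ^ n * x] infinitely often. *)
Lemma nonintegral_unit_not_hereditarily_atomic (R : idomainType) (u x : R) :
  u \is a GRing.unit -> ~ integral_over (prime_subring R) u ->
  transcendental_over
    (field_adjoin (prime_quotient_field R) [set tofrac u]) (tofrac x) ->
  ~ hereditarily_atomic R.
Proof.
move=> Uu nint trx; set F := field_adjoin _ _ in trx.
have HZ := @prime_subring_subring R.
have HF : is_subfield F by exact: field_adjoin_subfield.
have HA := eval_ring_subring u^-1 HZ.
apply: (transcendental_not_hereditarily_atomic (y := fun=> u^-1)
  (z := fun n => u ^+ n * x) HA HF).
- apply: eval_ring_min; first exact: subfield_preimage_subring.
    by move=> a /tofrac_prime_subring; exact: field_adjoin_base.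
  rewrite /preimage /= rmorphV //; apply: (subfieldV HF).
  exact: field_adjoin_gen.
- by move=> _; exact: eval_ring_gen.
- move=> _ [_ [b Ab ub1]]; apply: nint; apply: integral_of_eval_inv => //.
  have ub : u = b by rewrite -[LHS]mulr1 -ub1 mulVKr.
  by rewrite [X in eval_ring _ _ X]ub.
- by move=> n; rewrite exprS -mulrA mulKr.
- by rewrite expr0 mul1r.
Qed.

(** * Inheritance of the chain condition *)

(** Every nonzero [s] of a subring is invertible in it: its inverse in the
fraction field is integral over the prime field, which the subring
contains. *)
Lemma algebraic_pchar_hereditarily_ACCP (R : idomainType) :
  positive_char {fraction R} ->
  (forall x, algebraic_over (prime_quotient_field R) x) ->
  hereditarily_ACCP R.
Proof.
move=> pcharK algK S HS; apply: ACCP_field => // s Ss s0.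
have HQ := prime_quotient_subfield R.
have QS : prime_quotient_field R `<=` [set tofrac a | a in S].
  move=> a /(prime_quotient_pchar pcharK)[b Zb <-]; exists b => //.
  exact: prime_subring_sub HS _ Zb.
have sV : tofrac s * (tofrac s)^-1 = 1 by rewrite divff // tofrac_eq0.
have Ss' : [set tofrac a | a in S] (tofrac s) by exists s.
have [t St tE] := integral_inv_mem (subfield_subring HQ)
  (image_subring (@tofrac R) HS) QS Ss' sV (integral_of_algebraic HQ (algK _)).
split=> //; exists t => //; apply: (@tofrac_inj R).
by rewrite tofracM tE sV tofrac1.
Qed.

Lemma ACCP_hereditarily_ACCP (R : idomainType) :
  ACCP [set: R] ->
  (forall u : R, u \is a GRing.unit -> ~ integral_over (prime_subring R) u ->
     exists x : R, transcendental_over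
       (field_adjoin (prime_quotient_field R) [set tofrac u]) (tofrac x)) ->
  hereditarily_atomic R -> hereditarily_ACCP R.
Proof.
move=> accR trR hatR; apply: hereditarily_ACCP_integral_units => // u Uu.
apply: contrapT => nint; have [x trx] := trR u Uu nint.
exact: nonintegral_unit_not_hereditarily_atomic Uu nint trx hatR.
Qed.

(** As the prime subring is a field, [u] is transcendental over it; if
everything were algebraic over [Q(u)], then [u] would form a
transcendence basis. *)
Lemma trdeg_neq1_transcendental (R : idomainType) (u : R) :
  positive_char {fraction R} -> ~ trdeg_eq (prime_quotient_field R) 1 ->
  ~ integral_over (prime_subring R) u ->
  exists x, transcendental_over
    (field_adjoin (prime_quotient_field R) [set tofrac u]) x.
Proof.
move=> pcharK ntr1 nint; apply: contrapT => nex; apply: ntr1.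
have HQ := prime_quotient_subfield R.
exists [set tofrac u]; last exact: card_set1.
split; last by move=> x; apply: contrapT => trx; apply: nex; exists x.
apply: algebraically_independent1 => // algu; apply: nint.
exact: integral_over_pchar.
Qed.

(* Sequences indexed by the positive integers in the source are indexed here
   by nat from 0: y n stands for y_(n+1), so that y_1 ... y_(n+1) is
   \prod_(i < n.+1) y i.  In (6), z n is the element x / (y_1 ... y_n) of R. *)
Theorem theorem6p4 (R : idomainType) :
  let K : fieldType := {fraction R} in
  let Z : set R := prime_subring R in
  let Q : set K := prime_quotient_field R in
  (* (1) *)
  (exists u : R,
     [/\ u \is a GRing.unit, ~ integral_over Z u &
         exists x : R,
           transcendental_over (field_adjoin Q [set tofrac u]) (tofrac x)])
  (* (2) *)
  \/ (positive_char K /\ forall x : K, algebraic_over Q x)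
  (* (3) *)
  \/ ([/\ positive_char K, ACCP [set: R] & ~ trdeg_eq Q 1]
      \/ [/\ zero_char K, ACCP [set: R] & trdeg_ge Q 2])
  (* (4) *)
  \/ (exists (y : nat -> R) (x : R),
        [/\ forall n, y n \isn't a GRing.unit,
            (\bigcap_n principal (\prod_(i < n.+1) y i)) x &
            transcendental_over
              (field_adjoin Q (range (fun n => tofrac (y n)))) (tofrac x)])
  (* (5) *)
  \/ (exists x : nat -> R,
        (forall n, principal (x n) `<` principal (x n.+1)) /\
        transcendental_over
          (field_adjoin Q (range (fun n => tofrac (x n) / tofrac (x n.+1))))
          (tofrac (x 0%N)))
  (* (6) *)
  \/ (exists (x : R) (y z : nat -> R),
        [/\ x != 0 /\ x \isn't a GRing.unit,
            forall n, y n != 0 /\ y n \isn't a GRing.unit,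
            (\bigcap_n principal (\prod_(i < n.+1) y i)) x &
            [/\ forall n, tofrac (z n) = tofrac x / tofrac (\prod_(i < n) y i),
                forall n, principal (z n) `<` principal (z n.+1) &
                ring_adjoin Z (range y) `&` ideal_gen (range z) = [set 0]]])
  (* (7) *)
  \/ (let S := [set z : R | z != 0 /\
                  (principal z = [set: R] \/ infinite_chain_from z)] in
      saturated S /\ ~ (S `<=` [set u | u \is a GRing.unit]))
  -> (hereditarily_atomic R <-> hereditarily_ACCP R).
Proof.
move=> K Z Q conds; split; last exact: hereditarily_ACCP_atomic.
have HQ : is_subfield Q := prime_quotient_subfield R.
case: conds => [|[|[|[|[|[|]]]]]].
- move=> [u [Uu nint [x trx]]] hatR.
  by case: (nonintegral_unit_not_hereditarily_atomic Uu nint trx hatR).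
- by move=> [pcharK algK] _; exact: algebraic_pchar_hereditarily_ACCP.
- case=> [[pcharK accR ntr1]|[_ accR tr2]];
    apply: ACCP_hereditarily_ACCP => // u Uu nint;
    apply: transcendental_fraction; try exact: field_adjoin_subfield.
    exact: trdeg_neq1_transcendental.
  exact: trdeg_ge2_transcendental.
- move=> [y [x [nUy xy trx]]] hatR; set F := field_adjoin _ _ in trx.
  have HF : is_subfield F by exact: field_adjoin_subfield.
  have x0 : x != 0.
    apply/eqP => x0; apply: trx; rewrite x0 tofrac0.
    by apply: algebraic_base => //; exact: subfield0.
  have [z z0 zE] := successive_quotients x0 xy.
  exfalso; apply: (transcendental_not_hereditarily_atomic (y := y) (z := z)
    (subfield_preimage_subring HF) HF) hatR; last by rewrite z0.
  + by [].
  + by move=> n; apply: field_adjoin_gen; exists n.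
  + move=> n [_ [b _ yb1]]; have /negP := nUy n; apply.
    by apply/unit_in_setT; split=> //; exists b.
  + exact: zE.
- move=> [x [xS trx]] hatR; set F := field_adjoin _ _ in trx.
  have HF : is_subfield F by exact: field_adjoin_subfield.
  have /choice[y yP] n : exists y, x n = y * x n.+1.
    have [s _ xs] := (principal_inP (x n) (x n.+1) (subringT R)).1 (xS n).1.
    by exists s.
  have x0 n : x n != 0.
    elim: n => [|n IH]; last first.
      by apply: contraNneq IH => xn0; rewrite yP xn0 mulr0.
    apply/eqP => x0; apply: trx; rewrite x0 tofrac0.
    by apply: algebraic_base => //; exact: subfield0.
  exfalso; apply: (transcendental_not_hereditarily_atomic (y := y) (z := x)
    (subfield_preimage_subring HF) HF) hatR => //.
  + move=> n; apply: field_adjoin_gen; exists n => //.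
    by rewrite {1}yP tofracM mulfK // tofrac_eq0.
  + move=> n [_ [b _ yb1]]; have [_] := xS n; apply.
    apply: (principal_in_mono (s := b) (subringT R)) => //.
    by rewrite (yP n) mulrA [b * _]mulrC yb1 mul1r.
- move=> [x [y [z [[x0 _] yP xy [zE _ AP0]]]]] hatR.
  have HA := ring_adjoin_subring Z (range y).
  have y0 n : y n != 0 by have [] := yP n.
  have prod0 n : tofrac (\prod_(i < n) y i) != 0.
    by rewrite tofrac_eq0; apply/prodf_neq0 => i _.
  have z0 : z 0%N = x.
    by apply: (@tofrac_inj R); rewrite zE big_ord0 tofrac1 divr1.
  exfalso; apply: (chain_not_hereditarily_atomic (y := y) (z := z)
    HA (subringT R)) hatR => //; last 1 first.
  + move=> n b _ Azb; suff : [set 0] (z n * b) by [].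
    rewrite -AP0; split=> // I [[I0 ID IM] sI].
    by rewrite mulrC; apply: IM; apply: sI; exists n.
  + by move=> n T [_]; apply; right; exists n.
  + move=> n [_ [b _ yb1]]; have [_ /negP] := yP n; apply.
    by apply/unit_in_setT; split=> //; exists b.
  + move=> n; apply: (@tofrac_inj R); rewrite tofracM !zE big_ord_recr /=.
    have yn0 : tofrac (y n) != 0 by rewrite tofrac_eq0.
    rewrite tofracM invfM [_ * (tofrac x * _)]mulrCA.
    by rewrite [in RHS](mulrC _^-1) mulVKf.
  + by rewrite z0.
- move=> [[_ _ _ satS] nSU] hatR; apply: contrapT => _; apply: nSU => z Sz.
  apply: contrapT => /negP nUz; have [z0 _] := Sz.
  have [d [c zdc [d0 nUd nch]]] := atomic_no_chain_divisor
    (hatR _ (subringT R)) z0 nUz.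
  have [_ [dT|//]] := satS z d c Sz zdc.
  by move: nUd; rewrite (principal_unit d).1.
Qed.
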